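(* Let $C$ be a graph with $\mathrm{diam}(C)>1$. For a graph $P$: (1) if $\mathrm{diam}(P)=\infty$, then $A_{ucg}(C,P)=4$; (2) if $5\leq \mathrm{diam}(P)<\infty$, then $A_{ucg}(C,P)=5$; (3) if $\mathrm{diam}(P)=4$ and $r(P)=4$, then $A_{ucg}(C,P)\in\{5,6\}$; (4) if $\mathrm{diam}(P)=4$ and $r(P)=2$, then $A_{ucg}(C,P)=6$; (5) if $\mathrm{diam}(P)=3$, then $A_{ucg}(C,P)=6$. Furthermore, for every $t\in\mathbb{Z}$ there is a graph $P$ with $\mathrm{diam}(P)=r(P)=2$ and $A_{ucg}(C,P)\geq t$.
   Context: All graphs are finite and simple. $d(u,v)$ denotes distance ($\infty$ if no path). Eccentricity $e(v)=\max_u d(u,v)$; radius $r(G)$ = minimum eccentricity, diameter $\mathrm{diam}(G)$ = maximum eccentricity (so a disconnected graph has infinite diameter). For a graph $H$: the center $Z(H)$ is the set of vertices of minimum eccentricity; $EC(v)=\{x: d(v,x)=e(v)\}$; the centered periphery is $CP(H)=\bigcup_{z\in Z(H)} EC(z)$; $\langle S\rangle$ is the induced subgraph on $S$. $H$ is a uniform central graph (UCG) if $EC(c)$ is the same for all $c\in Z(H)$. $I(H)=V(H)\setminus(Z(H)\cup CP(H))$. For graphs $C,P$, $A_{ucg}(C,P)$ is the minimum of $|I(H)|$ over all UCGs $H$ with $\langle Z(H)\rangle\cong C$ and $\langle CP(H)\rangle\cong P$, and $\infty$ if no such $H$ exists. *)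

(* Defs.v *)
From HB Require Import structures.
From mathcomp Require Import all_boot all_order all_algebra.
From mathcomp Require Import boolp constructive_ereal.

Set Implicit Arguments.
Unset Strict Implicit.
Unset Printing Implicit Defensive.

Import Order.TTheory GRing.Theory Num.Theory.

Local Open Scope ring_scope.
Local Open Scope ereal_scope.

Record sgraph := SGraph {
  vertex :> finType;
  adj : rel vertex;
  adj_sym : symmetric adj;
  adj_irr : irreflexive adj }.

(* Lengths, eccentricities and minima live in the extended integers [\bar int]
   so that they may be [+oo]; the value [-oo] never occurs. *)

(* The minimum of [S], and [+oo] when [S] is empty. *)
Definition nat_inf (S : nat -> Prop) : \bar int :=
  if pselect (exists k, `[< S k >]) is left exS then (ex_minn exS)%:Z%:E
  else +oo.

Section Graph.
Variable G : sgraph.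
Implicit Types u v : G.

(* A walk from [u] to [v] is a sequence [u :: p] with [last u p = v]; its
   length is [size p]. *)
Definition dist u v : \bar int :=
  nat_inf (fun k => exists p : seq G,
    [/\ path (@adj G) u p, last u p = v & size p = k]).

Definition ecc v : \bar int := \big[Order.max/0]_(u : G) dist u v.

(* On the graph without vertices, [radius] is [+oo] and [diam] is [0]. *)
Definition radius : \bar int := \big[Order.min/+oo]_(v : G) ecc v.
Definition diam : \bar int := \big[Order.max/0]_(v : G) ecc v.

Definition center : {set G} := [set v | ecc v == radius].

Definition EC v : {set G} := [set x | dist v x == ecc v].

Definition CP : {set G} := \bigcup_(z in center) EC z.

Definition ucg : Prop := {in center &, forall c c', EC c = EC c'}.

Definition intermediate : {set G} := ~: (center :|: CP).

Definition induced_adj (S : {set G}) : rel {x : G | x \in S} :=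
  fun x y => adj (val x) (val y).

Lemma induced_adj_sym (S : {set G}) : symmetric (@induced_adj S).
Proof. by move=> x y; apply: adj_sym. Qed.

Lemma induced_adj_irr (S : {set G}) : irreflexive (@induced_adj S).
Proof. by move=> x; apply: adj_irr. Qed.

Definition induced (S : {set G}) : sgraph :=
  SGraph (@induced_adj_sym S) (@induced_adj_irr S).

End Graph.

Definition giso (G H : sgraph) : Prop :=
  exists2 f : G -> H, bijective f & {mono f : x y / adj x y}.

Definition A_ucg (C P : sgraph) : \bar int :=
  nat_inf (fun k => exists H : sgraph,
    [/\ ucg H, giso (induced (center H)) C, giso (induced (CP H)) P
      & #|intermediate H| = k]).

(* Main.v *)
Require Import Defs.
From HB Require Import structures.
From mathcomp Require Import all_boot all_order all_algebra.
From mathcomp Require Import zify.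
From mathcomp Require Import boolp constructive_ereal.

(* In a uniform central graph H of radius r whose center Z is not a clique, two
   non-adjacent central vertices are at distance less than r, so r >= 3.  For c
   in Z and a neighbor x of c on a shortest walk to the periphery P, x is not
   central, hence misses some vertex of P by more than r; the shortest walks
   from c to P through x and to that vertex have disjoint interiors, and there
   are at least 2 (r - 1) intermediate vertices.  So fewer than 6 of them forces
   r = 3.  Then let the feet be the intermediate vertices adjacent to P.  With
   two feet, the sets of their neighbors cover P; an edge of P between the two
   sets has ends of eccentricity at most 3 unless there is a fifth intermediate
   vertex adjacent to Z, and then the feet have eccentricity more than 3 only
   if P has diameter at least 5.  With three feet, such an edge yields two
   vertices of P at distance at least 4, and a vertex of P within 2 of all of P
   is excluded.

   Conversely, hang from Z two legs of two vertices, ending in the two parts of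
   a bipartition of P, and a pendant leg with 0, 1 or 2 vertices.

   For the last claim, if H has fewer than m intermediate vertices then P is
   covered by fewer than m sets none of which is dominating, which is
   impossible when P is the complete multipartite graph with m parts of size
   2. *)

Set Implicit Arguments.
Unset Strict Implicit.
Unset Printing Implicit Defensive.

Import Order.TTheory GRing.Theory Num.Theory.

Local Open Scope nat_scope.

(** * Extended natural numbers *)

Local Notation "n %:N" := (n%:Z%:E%E) (at level 1, format "n %:N").

(** Rules out negative values and [-oo], so that such numbers are determined by their comparisons
    with naturals ([enat_eq]). *)
Definition is_enat (x : \bar int) := x = +oo%E \/ exists n : nat, x = n%:N.

Lemma lee_enat (m n : nat) : (m%:N <= n%:N)%E = (m <= n).
Proof. by rewrite lee_fin lez_nat. Qed.

Lemma nat_inf_enat S : is_enat (nat_inf S).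
Proof.
by rewrite /nat_inf; case: pselect => [ex|_]; [right; eexists|left].
Qed.

Lemma nat_inf_leP S n :
  reflect (exists2 k, k <= n & S k) (nat_inf S <= n%:N)%E.
Proof.
rewrite /nat_inf; case: pselect => [ex|nex].
  case: ex_minnP => m /asboolP Sm minm; rewrite lee_enat.
  apply: (iffP idP) => [mn|[k kn Sk]]; first by exists m.
  by apply: leq_trans kn; apply: minm; apply/asboolP.
rewrite leye_eq; constructor => -[k _ Sk].
by apply: nex; exists k; apply/asboolP.
Qed.

Lemma nat_inf_geP S n :
  reflect (forall k, S k -> n <= k) (n%:N <= nat_inf S)%E.
Proof.
rewrite /nat_inf; case: pselect => [ex|nex].
  case: ex_minnP => m /asboolP Sm minm; rewrite lee_enat.
  apply: (iffP idP) => [nm k Sk|]; last by apply.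
  by apply: leq_trans nm _; apply: minm; apply/asboolP.
rewrite leey; constructor => k Sk.
by case: nex; exists k; apply/asboolP.
Qed.

Lemma enat_eq x y : is_enat x -> is_enat y ->
  (forall n : nat, (x <= n%:N)%E = (y <= n%:N)%E) -> x = y.
Proof.
case=> [->|[m ->]] [->|[n ->]] // xy.
- by have := xy n; rewrite leye_eq lexx.
- by have := xy m; rewrite leye_eq lexx.
- apply/eqP; rewrite eq_le; move: (xy n) (xy m); rewrite !lexx => -> <-.
  by [].
Qed.

Lemma enat_leN x (n : nat) : is_enat x ->
  ~~ (x <= n%:N)%E -> ((n.+1)%:N <= x)%E.
Proof. by case=> [->|[m ->]]; rewrite ?leey // !lee_enat -ltnNge. Qed.

Lemma enat_max x y : is_enat x -> is_enat y -> is_enat (Order.max x y).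
Proof. by move=> ? ?; rewrite maxEle; case: ifP. Qed.

Lemma enat_min x y : is_enat x -> is_enat y -> is_enat (Order.min x y).
Proof. by move=> ? ?; rewrite minEle; case: ifP. Qed.

(** * Walks of bounded length, and the metric notions in terms of them *)

Section Reach.
Variable G : sgraph.
Implicit Types u v w : G.

(** A decidable form of [dist u v <= n], see [dist_le]. It keeps extended integers out of the
    combinatorial arguments. *)
Fixpoint reach n u v : bool :=
  if n is n'.+1 then reach n' u v || [exists w, adj u w && reach n' w v]
  else u == v.

Lemma reachS n u v :
  reflect (reach n u v \/ exists2 w, adj u w & reach n w v) (reach n.+1 u v).
Proof.
apply: (iffP orP) => [[uv|/existsP[w /andP[uw wv]]]|[uv|[w uw wv]]].
- by left.
- by right; exists w.
- by left.
- by right; apply/existsP; exists w; rewrite uw.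
Qed.

Lemma reach0 u : reach 0 u u. Proof. exact: eqxx. Qed.

Lemma reach_leq m n u v : m <= n -> reach m u v -> reach n u v.
Proof.
move=> /subnK <-; elim: (n - m) => // k IH /IH uv.
by rewrite addSn; apply/reachS; left.
Qed.

Lemma reach_adj u v : adj u v -> reach 1 u v.
Proof. by move=> uv; apply/reachS; right; exists v => //; apply: reach0. Qed.

Lemma reach_trans m n v u w : reach m u v -> reach n v w -> reach (m + n) u w.
Proof.
elim: m u => [|m IH] u; first by move=> /eqP ->.
case/reachS=> [uv vw|[x ux xv] vw]; rewrite addSn; apply/reachS.
  by left; apply: IH.
by right; exists x => //; apply: IH.
Qed.

Lemma reach_sym n : symmetric (reach n).
Proof.
have imp u v : reach n u v -> reach n v u.
  elim: n u => [|n IH] u; first by rewrite /= eq_sym.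
  case/reachS=> [uv|[x ux xv]]; first by apply: reach_leq (IH _ uv).
  rewrite -addn1; apply: (reach_trans (IH _ xv)).
  by apply: reach_adj; rewrite adj_sym.
by move=> u v; apply/idP/idP; apply: imp.
Qed.

Lemma reach_split m n u w : reach (m + n) u w ->
  exists2 v, reach m u v & reach n v w.
Proof.
elim: m u => [|m IH] u; first by exists u => //; apply: reach0.
rewrite addSn => /reachS[/IH[v uv vw]|[x ux /IH[v xv vw]]].
  by exists v => //; apply: reach_leq uv.
by exists v => //; apply/reachS; right; exists x.
Qed.

Lemma reach1P u v : reflect (u = v \/ adj u v) (reach 1 u v).
Proof.
apply: (iffP (reachS _ _ _)) => [[/eqP ?|[w uw /eqP <-]]|[->|uv]].
- by left.
- by right.
- by left; apply: reach0.
- by right; exists v => //; apply: reach0.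
Qed.

Lemma reach_cross n (S : pred G) u v : reach n u v -> S u -> ~~ S v ->
  exists p q, [/\ S p, ~~ S q & adj p q].
Proof.
elim: n u => [|n IH] u; first by move=> /eqP -> ->.
case/reachS=> [/IH//|[w uw wv]] Su Sv.
have [Sw|nSw] := boolP (S w); first exact: IH wv Sw Sv.
by exists u, w.
Qed.

Lemma reach_lip (f : G -> nat) :
  (forall x y, adj x y -> f y <= (f x).+1) ->
  forall n u v, reach n u v -> f v <= f u + n.
Proof.
move=> lip; elim=> [|n IH] u v; first by move=> /eqP ->; rewrite addn0.
case/reachS=> [/IH|[w /lip uw /IH]]; lia.
Qed.

Lemma reach_path n u v : reflect
  (exists2 k, k <= n & exists p : seq G,
    [/\ path (@adj G) u p, last u p = v & size p = k]) (reach n u v).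
Proof.
apply: (iffP idP) => [|[k kn [p [up <- sp]]]]; last first.
  apply: reach_leq kn _; elim: p u k up sp => [|w p IH] u k /= up <-.
    exact: reach0.
  by case/andP: up => uw wp; apply/reachS; right; exists w => //; apply: IH.
elim: n u => [|n IH] u; first by move=> /eqP->; exists 0 => //; exists [::].
case/reachS=> [/IH[k kn ex]|[w uw /IH[k kn [p [wp lp sp]]]]].
  by exists k => //; apply: ltnW.
by exists k.+1 => //; exists (w :: p); rewrite /= uw sp.
Qed.

Lemma dist_le n u v : (dist u v <= n%:N)%E = reach n u v.
Proof. exact/nat_inf_leP/reach_path. Qed.

Lemma dist_enat u v : is_enat (dist u v).
Proof. exact: nat_inf_enat. Qed.

Lemma ecc_enat v : is_enat (ecc v).
Proof.
rewrite /ecc; elim/big_ind: _ => [||u _]; first by right; exists 0.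
- exact: enat_max.
- exact: dist_enat.
Qed.

Lemma ecc_le n v : (ecc v <= n%:N)%E = [forall u, reach n v u].
Proof.
apply/bigmax_leP/forallP => [[_ h] u|h].
  by rewrite reach_sym -dist_le; apply: h.
by split=> [|u _]; [rewrite (lee_enat 0)|rewrite dist_le reach_sym].
Qed.

Lemma radius_enat : is_enat (radius G).
Proof.
rewrite /radius; elim/big_ind: _ => [||u _]; first by left.
- exact: enat_min.
- exact: ecc_enat.
Qed.

Lemma radius_le n :
  (radius G <= n%:N)%E = [exists v : G, [forall u, reach n v u]].
Proof.
apply/bigmin_leP/existsP => [[|[v _]]|[v]]; first by rewrite leye_eq.
  by rewrite ecc_le; exists v.
by rewrite -ecc_le; right; exists v.
Qed.

Lemma diam_enat : is_enat (diam G).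
Proof.
rewrite /diam; elim/big_ind: _ => [||u _]; first by right; exists 0.
- exact: enat_max.
- exact: ecc_enat.
Qed.

Lemma diam_leP n :
  reflect (forall u v : G, reach n u v) (diam G <= n%:N)%E.
Proof.
apply: (iffP (bigmax_leP _ _ _ _)) => [[_ h] u v|h].
  by have := h u isT; rewrite ecc_le => /forallP/(_ v).
split=> [|u _]; first by rewrite (lee_enat 0).
by rewrite ecc_le; apply/forallP.
Qed.

Lemma diam_far n : (n.+1%:N <= diam G)%E -> exists u v : G, ~~ reach n u v.
Proof.
move=> dn; case: (boolP (diam G <= n%:N)%E) => [|/diam_leP].
  by move=> /(le_trans dn); rewrite lee_enat ltnn.
by move=> h; apply: contrapT => nex; apply: h => u v;
  apply: contrapT => /negP nuv; apply: nex; exists u, v.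
Qed.

Lemma diamy : diam G = +oo%E -> exists u v : G, forall n, ~~ reach n u v.
Proof.
move=> dy; have : (+oo <= diam G)%E by rewrite dy.
case/bigmax_geP => [|[v _]]; first by rewrite leye_eq.
case/bigmax_geP => [|[u _]]; first by rewrite leye_eq.
by rewrite leye_eq => /eqP uv; exists u, v => n; rewrite -dist_le uv leye_eq.
Qed.

End Reach.

Arguments reach : simpl never.

Lemma reach_hom (G H : sgraph) (f : G -> H) :
  {homo f : x y / adj x y} ->
  forall n u v, reach n u v -> reach n (f u) (f v).
Proof.
move=> hom; elim=> [|n IH] u v; first by move=> /eqP ->; apply: reach0.
case/reachS=> [/IH|[w /hom uw /IH]] h; apply/reachS; [by left|right].
by exists (f w).
Qed.

(* [H] is a uniform central graph of radius [r], center [Z] and centered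
   periphery [P]. *)
Record ucg_of (H : sgraph) (r : nat) (Z P : {set H}) : Prop := UcgOf {
  ucg_ne : exists c, c \in Z;
  ucg_per_ne : exists p, p \in P;
  ucg_ecc : forall c v, c \in Z -> reach r c v;
  ucg_per : forall c v, c \in Z -> (v \in P) = ~~ reach r.-1 c v;
  ucg_far : forall v, v \notin Z -> exists u, ~~ reach r v u }.

(** * Uniform central graphs in terms of bounded walks *)

Lemma EC_ecc (H : sgraph) (c : H) (r : nat) : 0 < r -> ecc c = r%:N ->
  EC c = [set v | ~~ reach r.-1 c v].
Proof.
move=> r0 ec; apply/setP => v; rewrite !inE ec -dist_le.
have : (dist c v <= r%:N)%E.
  by rewrite dist_le; apply/forallP: v; rewrite -ecc_le ec.
case: (dist_enat c v) => [->|[n ->]]; first by rewrite leye_eq.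
rewrite !lee_enat => nr; apply/eqP/idP => [[->]|]; first by lia.
by rewrite -ltnNge prednK // => rn; congr (_%:N); lia.
Qed.

(** A central vertex is at distance 0 from itself, so it is outside the common periphery and within
    [r - 1] of every other central vertex. Distinct non-adjacent ones force [r - 1] to be at least
    2. *)
Lemma ucg_of_ucg (H : sgraph) : ucg H ->
  (exists c c', [/\ c \in center H, c' \in center H, c != c' & ~~ adj c c']) ->
  exists2 r, 2 < r & ucg_of r (center H) (CP H).
Proof.
move=> uH [c [c' [cZ c'Z cc' nadj]]].
have EC0 (z : H) : (0%:N < ecc z)%E -> z \notin EC z.
  rewrite inE; apply: contraTneq => <-.
  by rewrite -leNgt dist_le reach0.
have eccZ z : z \in center H -> ecc z = radius H by rewrite inE => /eqP.
have CPE z : z \in center H -> CP H = EC z.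
  move=> zZ; apply/setP => v; apply/bigcupP/idP => [[y yZ]|].
    by rewrite (uH _ _ yZ zZ).
  by exists z.
have pos : (0%:N < radius H)%E.
  rewrite ltNge radius_le; apply/negP => /existsP[v /forallP h].
  by case/negP: cc'; rewrite -(eqP (h c)) -(eqP (h c')).
(* With an infinite radius every vertex would be central; by uniformity, a vertex [x] of [EC c]
   would belong to [EC x]. *)
have [Ry|[r Rr]] := radius_enat H.
  have all_c v : v \in center H.
    by rewrite inE Ry -leye_eq -Ry; apply: bigmin_le.
  have [x xc] : exists x, x \in EC c.
    have : (+oo <= ecc c)%E by rewrite eccZ // Ry.
    case/bigmax_geP => [|[u _]]; first by rewrite leye_eq.
    move=> hu; exists u; rewrite inE eccZ // Ry; move: hu; rewrite !leye_eq.
    move=> /eqP uc; apply/eqP; rewrite -uc; apply: enat_eq => [||n].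
    - exact: dist_enat.
    - exact: dist_enat.
    - by rewrite !dist_le reach_sym.
  move: xc; rewrite (uH c x) // => xx.
  by have := EC0 x; rewrite xx eccZ // => /(_ pos).
have r0 : 0 < r by move: pos; rewrite Rr ltNge lee_enat -ltnNge.
have per z v : z \in center H -> (v \in CP H) = ~~ reach r.-1 z v.
  by move=> zZ; rewrite (CPE z) // (EC_ecc r0) ?inE // eccZ.
exists r.
  rewrite ltnNge; apply/negP => r2.
  have : c' \notin CP H by rewrite (CPE c') // EC0 // eccZ.
  rewrite (per c) // negbK => /(@reach_leq _ _ 1) => /(_ ltac:(lia)).
  by case/reach1P => [cE|]; [rewrite cE eqxx in cc'|apply/negP].
split=> //.
- by exists c.
- apply: contrapT => nex; have : (ecc c <= r.-1%:N)%E.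
    rewrite ecc_le; apply/forallP => u; apply: contrapT => /negP hu.
    by apply: nex; exists u; rewrite (per c).
  by rewrite eccZ // Rr lee_enat; lia.
- by move=> z v zZ; apply/forallP: v; rewrite -ecc_le eccZ // Rr.
- move=> v; rewrite inE => vr; apply: contrapT => nex.
  have : (ecc v <= r%:N)%E.
    rewrite ecc_le; apply/forallP => u; apply: contrapT => /negP hu.
    by apply: nex; exists u.
  rewrite -Rr => er; case/negP: vr; rewrite eq_le er /=.
  exact: bigmin_le.
Qed.

(** The converse of [ucg_of_ucg], by which the graph [legs] below is recognized as a uniform central
    graph. *)
Lemma ucg_of_center (H : sgraph) r (Z P : {set H}) :
  0 < r -> ucg_of r Z P -> [/\ ucg H, center H = Z & CP H = P].
Proof.
move=> r0 [[c cZ] [p pP] hecc hper hfar].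
have eZ z : z \in Z -> ecc z = r%:N.
  move=> zZ; apply: enat_eq => [||n]; first exact: ecc_enat.
    by right; exists r.
  rewrite ecc_le lee_enat; apply/forallP/idP => [h|rn u].
    rewrite leqNgt; apply/negP => nr; move: pP; rewrite (hper z) //.
    by rewrite (@reach_leq _ n) //; lia.
  by apply: reach_leq rn _; apply: hecc.
have eNZ z : z \notin Z -> ~~ (ecc z <= r%:N)%E.
  case/hfar => u; rewrite ecc_le => hu.
  by apply/negP => /forallP/(_ u); apply/negP.
have Rr : radius H = r%:N.
  apply: le_anti; apply/andP; split; first by rewrite -(eZ c) // bigmin_le.
  apply/bigmin_geP; split=> [|z _]; first exact: leey.
  have [/eZ->//|/eNZ] := boolP (z \in Z).
  by rewrite -ltNge => /ltW.
have ZE : center H = Z.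
  apply/setP => z; rewrite inE Rr; have [/eZ->|/eNZ h] := boolP (z \in Z).
    by rewrite eqxx.
  by apply: contraNF h => /eqP ->.
have EE z : z \in Z -> EC z = P.
  by move=> zZ; rewrite (EC_ecc r0 (eZ _ zZ)); apply/setP => v; rewrite inE (hper z).
split=> //; first by rewrite /ucg ZE => z z' zZ z'Z; rewrite !EE.
apply/setP => v; rewrite /CP ZE; apply/bigcupP/idP => [[z zZ]|].
  by rewrite EE.
by exists c => //; rewrite EE.
Qed.

(** * Lower bounds *)

Lemma reachxx (G : sgraph) n (u : G) : reach n u u.
Proof. exact: (@reach_leq _ 0 n _ _ _ (reach0 u)). Qed.

Lemma adj_reach (G : sgraph) n (u v w : G) :
  adj u v -> reach n v w -> reach n.+1 u w.
Proof. by move=> uv vw; apply/reachS; right; exists v. Qed.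

Lemma adjC_reach (G : sgraph) n (u v w : G) :
  adj v u -> reach n v w -> reach n.+1 u w.
Proof. by rewrite adj_sym; apply: adj_reach. Qed.

(* Proves [reach n u v] by searching for a walk along the adjacencies (in
   either direction) of the context. *)
Ltac walk :=
  solve [ exact: reachxx
        | assumption
        | match goal with
          | h : is_true (adj ?u ?v) |- is_true (reach _.+1 ?u _) =>
            apply: (adj_reach h); walk
          | h : is_true (adj ?v ?u) |- is_true (reach _.+1 ?u _) =>
            apply: (adjC_reach h); walk
          end ].

Lemma mem_uniq_card (T : finType) (A : {set T}) (s : seq T) :
  uniq s -> {subset s <= A} -> #|A| <= size s -> A =i s.
Proof.
move=> us sA As v.
have sE : {subset s <= enum A} by move=> x /sA; rewrite mem_enum.
have sz : size (enum A) <= size s by rewrite -cardE.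
by have [_ ->] := uniq_min_size us sE sz; rewrite mem_enum.
Qed.

Section LowerBound.
Variables (H : sgraph) (r : nat) (Z P : {set H}).
Hypotheses (U : ucg_of r Z P) (r_gt1 : 1 < r).
Local Notation I := (~: (Z :|: P)).

Lemma center_notin_per z : z \in Z -> z \notin P.
Proof. by move=> zZ; rewrite (ucg_per U _ zZ) negbK reachxx. Qed.

Lemma inner_vertex c p x i : c \in Z -> p \in P -> 0 < i < r ->
  reach i c x -> reach (r - i) x p -> x \in I.
Proof.
move=> cZ pP ir cx xp; rewrite !inE negb_or; apply/andP; split.
  apply/negP => xZ; move: pP; rewrite (ucg_per U _ xZ).
  by rewrite (reach_leq _ xp) //; lia.
by rewrite (ucg_per U _ cZ) negbK (reach_leq _ cx) //; lia.
Qed.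

Lemma first_step c p : c \in Z -> p \in P ->
  exists a, [/\ adj c a, reach r.-1 a p & a \in I].
Proof.
move=> cZ pP; have := ucg_ecc U p cZ; rewrite -(ltn_predK r_gt1).
case/reachS => [|[a ca ap]].
  by move=> h; move: pP; rewrite (ucg_per U _ cZ) h.
exists a; split=> //; apply: (@inner_vertex c p a 1) => //.
  exact: reach_adj.
by rewrite subn1.
Qed.

(** A vertex at distance more than [r] from [a] is at distance more than [r - 1] from its neighbor
    [c], so it is peripheral. *)
Lemma neighbor_far c a : c \in Z -> adj c a -> a \notin Z ->
  exists2 y, y \in P & ~~ reach r a y.
Proof.
move=> cZ ca /(ucg_far U)[y ay]; exists y => //.
rewrite (ucg_per U _ cZ); apply: contra ay => cy.
by rewrite -(ltn_predK r_gt1); apply: adjC_reach cy.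
Qed.

Lemma inner_notin_center a : a \in I -> a \notin Z.
Proof. by rewrite !inE negb_or => /andP[]. Qed.

(* Two shortest walks of length [r] from a central vertex [c]: one through a
   neighbor [x1] of [c], the other to a vertex at distance more than [r] from
   [x1].  Their inner vertices are distinct. *)
Lemma card_inner : r.-1.*2 <= #|I|.
Proof.
have [[c cZ] [p pP]] := (ucg_ne U, ucg_per_ne U).
have [x1 [cx1 x1p x1I]] := first_step cZ pP.
have [y yP x1y] := neighbor_far cZ cx1 (inner_notin_center x1I).
have [y1 [cy1 y1y y1I]] := first_step cZ yP.
have split_at a q : reach r.-1 a q -> exists x : 'I_r.-1 -> H,
    forall i : 'I_r.-1, reach i a (x i) /\ reach (r.-1 - i) (x i) q.
  move=> aq; apply: (fin_all_exists
    (P := fun (i : 'I_r.-1) x => reach i a x /\ reach (r.-1 - i) x q)) => i.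
  have [|x ax xq] := @reach_split H i (r.-1 - i) a q.
    by rewrite subnKC //; apply: ltnW.
  by exists x.
have [xs xsP] := split_at _ _ x1p; have [ys ysP] := split_at _ _ y1y.
pose f (bi : bool * 'I_r.-1) := if bi.1 then xs bi.2 else ys bi.2.
pose q (b : bool) := if b then p else y.
have qP b : q b \in P by case: b.
have cf b (i : 'I_r.-1) : reach i.+1 c (f (b, i)).
  case: b => /=; rewrite /f /=; [apply: (adj_reach cx1)|apply: (adj_reach cy1)].
    by case: (xsP i).
  by case: (ysP i).
have fq b (i : 'I_r.-1) : reach (r.-1 - i) (f (b, i)) (q b).
  by case: b => /=; rewrite /f /=; [case: (xsP i)|case: (ysP i)].
(* Equal vertices at levels [i < j] would shorten the walk from [c] to [q b'] to less than [r]. *)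
have lt_f b b' (i j : 'I_r.-1) : i < j -> f (b, i) <> f (b', j).
  move=> ij ff; move: (qP b'); rewrite (ucg_per U _ cZ).
  have := reach_trans (cf b i); rewrite ff => /(_ _ _ (fq b' j)) h.
  by rewrite (reach_leq _ h) //; move: (ltn_ord j) ij; clear; lia.
(* At equal levels, switching walks would lead from [x1] to [y] in [r - 1] steps. *)
have ne_f (i : 'I_r.-1) : xs i <> ys i.
  move=> xy; case/negP: x1y.
  have := reach_trans (proj1 (xsP i)); rewrite xy => /(_ _ _ (proj2 (ysP i))).
  by apply: reach_leq; move: (ltn_ord i); clear; lia.
have f_inj : injective f.
  move=> [b i] [b' j] ff.
  have [ij|ji|/val_inj ij] := ltngtP i j.
  - by case: (lt_f b b' i j ij).
  - by case: (lt_f b' b j i ji).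
  rewrite ij in ff *; congr pair.
  by case: b b' ff => [] [] //= => [|/esym] /ne_f.
suff : #|[set f x | x : bool * 'I_r.-1]| <= #|I|.
  by rewrite card_imset // card_prod card_bool card_ord mul2n.
apply/subset_leq_card/subsetP => v /imsetP[[b i] _ ->].
apply: (@inner_vertex c (q b) _ i.+1) => //.
  by move: (ltn_ord i); clear; lia.
by rewrite (_ : r - i.+1 = r.-1 - i) //; clear; lia.
Qed.

End LowerBound.

(** * Radius three and at most five intermediate vertices *)

Section RadiusThree.
Variables (H : sgraph) (Z PP : {set H}) (P : sgraph) (g : P -> H).
Hypotheses (U : ucg_of 3 Z PP) (hom : {homo g : x y / adj x y}).
Hypothesis gP : forall v, v \in PP <-> exists p, v = g p.
Local Notation I := (~: (Z :|: PP)).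

Let gin p : g p \in PP. Proof. by apply/gP; exists p. Qed.

Lemma per3 c v : c \in Z -> (v \in PP) = ~~ reach 2 c v.
Proof. exact: (ucg_per U). Qed.

Lemma no_short c v p : c \in Z -> adj c v -> ~~ adj v (g p).
Proof.
move=> cZ cv; apply/negP => vp; have := gin p; rewrite (per3 _ cZ).
by case/negP; walk.
Qed.

Lemma three_walk c p : c \in Z -> exists a b,
  [/\ adj c a, adj a b, adj b (g p), a \in I & b \in I].
Proof.
move=> cZ; have [a [ca ap aI]] := first_step U isT cZ (gin p).
have nap : ~~ reach 1 a (g p).
  have := gin p; rewrite (per3 _ cZ); apply: contra => ap1.
  exact: adj_reach ap1.
case/reachS: ap => [h|[b ab]]; first by rewrite h in nap.
case/reach1P => [bE|bp]; first by rewrite -bE (reach_adj ab) in nap.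
exists a, b; split=> //; apply: (inner_vertex U isT cZ (gin p) (i := 2)) => //.
  by walk.
exact: reach_adj.
Qed.

Lemma vertex_cases v : [\/ v \in Z, exists p, v = g p | v \in I].
Proof.
have [vZ|vZ] := boolP (v \in Z); first by constructor 1.
have [/gP|vP] := boolP (v \in PP); first by constructor 2.
by constructor 3; rewrite !inE negb_or vZ.
Qed.

Lemma reach_center2 c v : c \in Z -> v \in I -> reach 2 v c.
Proof.
move=> cZ; rewrite !inE negb_or => /andP[_].
by rewrite (per3 _ cZ) negbK reach_sym.
Qed.

Lemma far_inner v : v \in I -> exists2 u, ~~ reach 3 v u &
  (exists p, u = g p) \/ u \in I.
Proof.
move=> vI; have [u vu] := ucg_far U (inner_notin_center vI).
exists u => //; case: (vertex_cases u) => [uZ|uP|uI]; [|by left|by right].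
by case/negP: vu; apply: reach_leq (reach_center2 uZ vI).
Qed.

Lemma far_per p : exists2 u, ~~ reach 3 (g p) u &
  (exists q, u = g q) \/ u \in I.
Proof.
have pZ : g p \notin Z.
  by apply/negP => /(center_notin_per U); rewrite gin.
have [u pu] := ucg_far U pZ.
exists u => //; case: (vertex_cases u) => [uZ|uP|uI]; [|by left|by right].
by case/negP: pu; rewrite reach_sym; apply: (ucg_ecc U).
Qed.

Let far_hom n p q : ~~ reach n (g p) (g q) -> ~~ reach n p q.
Proof. by apply: contra; apply: reach_hom. Qed.

Hypothesis conn : forall p q : P, exists n, reach n p q.

(** An edge of [P] from the neighbors of the foot [x2] to those of the foot [y2] has ends too close
    to everything but a fifth intermediate vertex [v]. This [v] turns out to be adjacent to [Z],
    hence within 3 of all of [I], so the feet must miss vertices of [P], which are then far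
    apart. *)
Lemma inner_two_feet c x1 x2 y1 y2 x w :
  c \in Z -> adj c x1 -> adj x1 x2 -> adj c y1 -> adj y1 y2 ->
  uniq [:: x1; x2; y1; y2] -> {subset [:: x1; x2; y1; y2] <= I} ->
  (forall b p, b \in I -> adj b (g p) -> b = x2 \/ b = y2) ->
  adj x2 (g x) -> ~~ adj x2 (g w) -> #|I| <= 5 ->
  #|I| = 5 /\ exists p q : P, ~~ reach 4 p q.
Proof.
move=> cZ cx1 x12 cy1 y12 us sI feet x2x x2w I5.
have cov p : ~~ adj x2 (g p) -> adj y2 (g p).
  move=> np; have [a [b [_ _ bp _ bI]]] := three_walk p cZ.
  by case: (feet b p bI bp) => bE; rewrite bE ?(negPf np) in bp.
have [n xw] := conn x w.
have [p [q [x2p x2q pq]]] := @reach_cross _ _ (fun p => adj x2 (g p)) _ _ xw x2x x2w.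
have y2q := cov q x2q; have gpq := hom pq.
have [[x1I x2I] [y1I y2I]] : (x1 \in I /\ x2 \in I) /\ (y1 \in I /\ y2 \in I).
  by split; split; apply: sI; rewrite !inE eqxx ?orbT.
have inP (a : P) : adj x2 (g a) \/ adj y2 (g a).
  by case: (boolP (adj x2 (g a))) => [|/cov]; [left|right].
(* Through [x2] and the edge [p q], the vertex [g p] is within 3 of [PP] and of the four named
   vertices. *)
have [v pv [[a vE]|vI]] := far_per p.
  by case/negP: pv; rewrite vE; case: (inP a) => ?; walk.
have vn : v \notin [:: x1; x2; y1; y2].
  by apply: contra pv; rewrite !inE => /or4P[] /eqP->; walk.
have us5 : uniq [:: v; x1; x2; y1; y2] by rewrite cons_uniq vn.
have sI5 : {subset [:: v; x1; x2; y1; y2] <= I}.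
  by move=> z; rewrite in_cons => /predU1P[->|/sI].
have IE := mem_uniq_card us5 sI5 I5.
have qv : ~~ reach 3 (g q) v.
  have [v' qv' [[a vE]|]] := far_per q.
    by case/negP: qv'; rewrite vE; case: (inP a) => ?; walk.
  rewrite IE in_cons => /predU1P[<-//|].
  by rewrite !inE => /or4P[] /eqP vE; case/negP: qv'; rewrite vE; walk.
have x1v : ~~ adj x1 v by apply: contra pv => ?; walk.
have y1v : ~~ adj y1 v by apply: contra qv => ?; walk.
(* A walk of length 2 from [c] to [v] can only pass through [Z]: the tops [x1] and [y1] are not
   adjacent to [v], and the feet are not adjacent to [c]. *)
have [d dZ dv] : exists2 d, d \in Z & adj d v.
  have := reach_center2 cZ vI; rewrite reach_sym => /reachS[/reach1P[]|].
  - by move=> cE; move: vI; rewrite -cE !inE cZ.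
  - by exists c.
  case=> u cu /reach1P[uE|uv]; first by exists c; rewrite -?uE.
  case: (vertex_cases u) => [uZ|[a uE]|]; first by exists u.
    move: (gin a); rewrite -uE (per3 _ cZ).
    by case/negP; walk.
  rewrite IE in_cons => /predU1P[uE|]; first by rewrite uE adj_irr in uv.
  rewrite !inE => /or4P[] /eqP uE.
  - by rewrite -uE uv in x1v.
  - by have := no_short x cZ cu; rewrite uE x2x.
  - by rewrite -uE uv in y1v.
  - by have := no_short q cZ cu; rewrite uE y2q.
have near z : z \in I -> reach 3 z v.
  by move=> zI; apply: (reach_trans (reach_center2 dZ zI)); walk.
have [y x2y] : exists y, ~~ reach 3 x2 (g y).
  have [u x2u [[a uE]|]] := far_inner x2I; first by exists a; rewrite -uE.
  rewrite IE in_cons => /predU1P[uE|]; first by rewrite uE near in x2u.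
  by rewrite !inE => /or4P[] /eqP uE; case/negP: x2u; rewrite uE; walk.
have [z y2z] : exists z, ~~ reach 3 y2 (g z).
  have [u y2u [[a uE]|]] := far_inner y2I; first by exists a; rewrite -uE.
  rewrite IE in_cons => /predU1P[uE|]; first by rewrite uE near in y2u.
  by rewrite !inE => /or4P[] /eqP uE; case/negP: y2u; rewrite uE; walk.
split; first by rewrite (eq_card IE); apply/card_uniqP.
(* The midpoint [m] of a walk of length 4 would be adjacent to a foot, putting [y] within 3 of [x2]
   or [z] within 3 of [y2]. *)
exists z, y; apply/negP => /(@reach_split _ 2 2)[m zm my].
case: (inP m) => h.
  by case/negP: x2y; apply: (adj_reach h); apply: reach_hom my.
case/negP: y2z; apply: (adj_reach h); rewrite reach_sym.
exact: reach_hom zm.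
Qed.

(** An edge of [P] from the set [X] of neighbors of [b1] or [b2] to a neighbor of [b3] starts at a
    vertex within 3 of all of [I], so this vertex must miss some vertex of [P]. A vertex [o] within
    2 of all of [P] is within 3 of the three feet, so it could only miss [a1] or [a2]; both are
    refuted. *)
Lemma inner_three_feet a1 a2 b1 b2 b3 :
  (forall c, c \in Z -> adj c a1 /\ adj c a2) ->
  adj a1 b1 -> adj a1 b2 -> adj a2 b3 ->
  I =i [:: a1; a2; b1; b2; b3] ->
  (exists p, adj b1 (g p)) -> (exists p, adj b2 (g p)) ->
  (exists p, adj b3 (g p)) ->
  (exists p q : P, ~~ reach 3 p q) /\ ~ exists o : P, forall p, reach 2 o p.
Proof.
move=> Za a1b1 a1b2 a2b3 IE [p1 b1p1] [p2 b2p2] [p3 b3p3].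
have [c cZ] := ucg_ne U; have [ca1 ca2] := Za c cZ.
have [a1I b3I] : a1 \in I /\ b3 \in I by split; rewrite IE !inE eqxx ?orbT.
have cov p : [\/ adj b1 (g p), adj b2 (g p) | adj b3 (g p)].
  have [a [b [_ _ bp _]]] := three_walk p cZ.
  rewrite IE !inE => /orP[|/or4P[]] /eqP bE; rewrite bE in bp.
  - by have := no_short p cZ ca1; rewrite bp.
  - by have := no_short p cZ ca2; rewrite bp.
  - by constructor 1.
  - by constructor 2.
  - by constructor 3.
pose X p := adj b1 (g p) || adj b2 (g p).
have covX p : ~~ X p -> adj b3 (g p).
  by rewrite /X negb_or => /andP[/negPf n1 /negPf n2]; case: (cov p); rewrite ?n1 ?n2.
have cross p q : X p -> adj b3 (g q) -> adj p q -> exists x, ~~ reach 3 p x.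
  move=> Xp b3q /hom pq; have [u pu [[a uE]|]] := far_per p.
    by exists a; apply: far_hom; rewrite -uE.
  rewrite IE !inE => uI; case/negP: pu.
  by case/orP: Xp => ?; case/orP: uI => [|/or4P[]] /eqP->; walk.
have [y nXy] : exists y, ~~ X y.
  have [y /gP[q ->] a1y] := neighbor_far U isT cZ ca1 (inner_notin_center a1I).
  by exists q; apply: contra a1y => /orP[] ?; walk.
split.
  have [n p1y] := conn p1 y.
  have [|p [q [Xp /covX b3q pq]]] := reach_cross p1y (S := X) _ nXy.
    by rewrite /X b1p1.
  by exists p; apply: cross pq.
case=> o ho.
have hgo p : reach 2 (g o) (g p) by apply: reach_hom.
have near_b b p : adj b (g p) -> reach 3 (g o) b.
  by move=> bp; apply: (reach_trans (hgo p)); walk.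
have [u ou [[a uE]|]] := far_per o.
  by case/negP: ou; rewrite uE; apply: reach_leq (hgo a).
rewrite IE !inE => /orP[|/or4P[]] /eqP uE; rewrite uE in ou; last first.
- by rewrite (near_b _ _ b3p3) in ou.
- by rewrite (near_b _ _ b2p2) in ou.
- by rewrite (near_b _ _ b1p1) in ou.
(* If [o] misses [a2], a walk from [o] to [p3] has a middle vertex [p] in [X], and [cross] makes [p]
   miss a vertex that [o] reaches in 2 steps. *)
- have b3o : ~~ adj b3 (g o) by apply: contra ou => ?; walk.
  case/reachS: (ho p3) => [/reach1P[oE|/hom o3]|[p op]].
  + by rewrite oE b3p3 in b3o.
  + by case/negP: ou; walk.
  case/reach1P => [pE|pp3]; have gop := hom op.
    by rewrite pE in gop; case/negP: ou; walk.
  have b3p : ~~ adj b3 (g p) by apply: contra ou => ?; walk.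
  have Xp : X p.
    by case: (cov p) => h; rewrite /X ?h ?orbT //; rewrite h in b3p.
  have [x px] := cross _ _ Xp b3p3 pp3.
  by case/negP: px; apply: adjC_reach op (ho x).
(* If [o] misses [a1], then [o] and its neighbors avoid [X], so they are all adjacent to [b3]. Then
   [b3] is within 3 of every vertex of [P] and [I], although it is not central. *)
have nX p : X p -> ~~ reach 1 o p.
  move=> Xp; apply: contra ou => /reach1P[->|/hom op].
    by case/orP: Xp => ?; walk.
  by case/orP: Xp => ?; walk.
have b3o : adj b3 (g o).
  by apply: covX; apply/negP => /nX; rewrite reachxx.
have b3P p : reach 2 b3 (g p).
  case/reachS: (ho p) => [/reach1P[<-|/hom op]|[q oq]]; try by walk.
  have b3q : adj b3 (g q).
    by apply: covX; apply/negP => /nX; rewrite (reach_adj oq).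
  by case/reach1P => [<-|/hom qp]; walk.
have [v b3v [[a vE]|]] := far_inner b3I.
  by rewrite vE (reach_leq _ (b3P a)) in b3v.
rewrite IE !inE => vI; case/negP: b3v.
case/orP: vI => [|/or4P[]] /eqP->; try by walk.
  by apply: (reach_trans (b3P p1)); walk.
by apply: (reach_trans (b3P p2)); walk.
Qed.

(** The first alternative comes from two feet; the second from a third foot, which is then the fifth
    intermediate vertex. *)
Lemma card_inner_conn : #|I| <= 5 ->
  #|I| = 5 /\ ((exists p q : P, ~~ reach 4 p q) \/
    (exists p q : P, ~~ reach 3 p q) /\ ~ exists o : P, forall p, reach 2 o p).
Proof.
move=> I5; have [[c cZ] [_ /gP[p0 _]]] := (ucg_ne U, ucg_per_ne U).
have second d a : d \in Z -> adj d a -> a \in I -> exists a' b p,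
    [/\ adj d a', adj a' b, adj b (g p), a' \in I & b \in I] /\ ~~ reach 3 a (g p).
  move=> dZ da /inner_notin_center aZ.
  have [_ /gP[p ->] ap] := neighbor_far U isT dZ da aZ.
  by have [a' [b h]] := three_walk p dZ; exists a', b, p.
(* Each leg ends next to a vertex of [P] missed by the top of the preceding leg: [y1] misses [x],
   which separates the two legs, and [x1] misses [v]. *)
have [a0 [b0 [ca0 _ _ a0I _]]] := three_walk p0 cZ.
have [y1 [y2 [y [[cy1 y12 y2y y1I y2I] _]]]] := second _ _ cZ ca0 a0I.
have [x1 [x2 [x [[cx1 x12 x2x x1I x2I] y1x]]]] := second _ _ cZ cy1 y1I.
have [v1 [v2 [v [[cv1 v12 v2v v1I v2I] x1v]]]] := second _ _ cZ cx1 x1I.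
have neB a b p : adj c a -> adj b (g p) -> a != b.
  by move=> ca bp; apply: contraTneq bp => <-; apply: no_short ca.
have us : uniq [:: x1; x2; y1; y2].
  rewrite /= !inE !negb_or (neB _ _ _ cx1 x2x) (neB _ _ _ cx1 y2y).
  rewrite (neB _ _ _ cy1 y2y) (eq_sym x2 y1) (neB _ _ _ cy1 x2x) !andbT /=.
  apply/andP; split.
    by apply: contra y1x => /eqP <-; walk.
  by apply: contra y1x => /eqP xy; rewrite -xy in y12; walk.
have sI : {subset [:: x1; x2; y1; y2] <= I}.
  by move=> z; rewrite !inE -!in_setU -in_setC => /or4P[] /eqP->.
have [feet|] := pselect
  (forall b p, b \in I -> adj b (g p) -> b = x2 \/ b = y2).
  have x2v : ~~ adj x2 (g v) by apply: contra x1v => ?; walk.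
  have [|h1 h2] :=
    inner_two_feet cZ cx1 x12 cy1 y12 us sI feet x2x x2v; first exact: I5.
  by split=> //; left.
move=> nfeet; have [b3 [p3 [b3I b3p3 b3x b3y]]] :
    exists b p, [/\ b \in I, adj b (g p), b != x2 & b != y2].
  apply: contrapT => nex; apply: nfeet => b p bI bp.
  have [->|bx] := eqVneq b x2; first by left.
  have [->|bY] := eqVneq b y2; first by right.
  by case: nex; exists b, p.
have us5 : uniq [:: b3; x1; x2; y1; y2].
  rewrite cons_uniq us andbT !inE !negb_or b3x b3y.
  by rewrite !(eq_sym b3) (neB _ _ _ cx1 b3p3) (neB _ _ _ cy1 b3p3).
have sI5 : {subset [:: b3; x1; x2; y1; y2] <= I}.
  by move=> z; rewrite in_cons => /predU1P[->|/sI].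
have IE := mem_uniq_card us5 sI5 I5.
have I5E : #|I| = 5 by rewrite (eq_card IE); apply/card_uniqP.
have upper d a : d \in Z -> adj d a -> a \in I -> a = x1 \/ a = y1.
  move=> dZ da; rewrite IE in_cons => /predU1P[aE|].
    by have := no_short p3 dZ da; rewrite aE b3p3.
  rewrite !inE => /or4P[] /eqP aE; [by left| |by right|].
    by have := no_short x dZ da; rewrite aE x2x.
  by have := no_short y dZ da; rewrite aE y2y.
(* Each central vertex has two distinct intermediate neighbors, by [second], and [upper] leaves only
   [x1] and [y1]. *)
have Za d : d \in Z -> adj d x1 /\ adj d y1.
  move=> dZ; have [a [b [da _ _ aI _]]] := three_walk p0 dZ.
  have [a' [b' [p [[da' a'b' b'p a'I _] ap]]]] := second _ _ dZ da aI.
  have naa' : a <> a' by move=> aE; case/negP: ap; rewrite aE; walk.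
  have [aE a'E] := (upper _ _ dZ da aI, upper _ _ dZ da' a'I).
  by move: da da' naa'; case: aE a'E => -> [] ->.
split=> //; right.
have [b3x1|b3y1] : adj x1 b3 \/ adj y1 b3.
  have := reach_center2 cZ b3I; rewrite reach_sym => /reachS[/reach1P[]|].
  - by move=> cE; move: b3I; rewrite -cE !inE cZ.
  - by move=> cb; have := neB _ _ _ cb b3p3; rewrite eqxx.
  case=> u cu /reach1P[uE|uv]; first by have := neB _ _ _ cu b3p3; rewrite uE eqxx.
  case: (vertex_cases u) => [uZ|[a uE]|uI].
  - by have := no_short p3 uZ uv; rewrite b3p3.
  - move: (gin a); rewrite -uE (per3 _ cZ).
    by case/negP; walk.
  by case: (upper _ _ cZ cu uI) => <-; [left|right].
- apply: (@inner_three_feet x1 y1 x2 b3 y2) => //; last 3 first.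
  + by exists x.
  + by exists p3.
  + by exists y.
  by move=> z; rewrite IE !inE; case: (z == b3); case: (z == x1); case: (z == x2);
    case: (z == y1); case: (z == y2).
- apply: (@inner_three_feet y1 x1 y2 b3 x2) => //; last 3 first.
  + by exists y.
  + by exists p3.
  + by exists x.
  + by move=> d /Za[].
  by move=> z; rewrite IE !inE; case: (z == b3); case: (z == x1); case: (z == x2);
    case: (z == y1); case: (z == y2).
Qed.

End RadiusThree.

(** * Cocktail party graphs *)

Section CocktailParty.
Variable m : nat.

Definition cocktail_adj : rel ('I_m * bool) := fun u v => u.1 != v.1.

Lemma cocktail_sym : symmetric cocktail_adj.
Proof. by move=> u v; rewrite /cocktail_adj eq_sym. Qed.

Lemma cocktail_irr : irreflexive cocktail_adj.
Proof. by move=> u; rewrite /cocktail_adj eqxx. Qed.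

Definition cocktail : sgraph := SGraph cocktail_sym cocktail_irr.

Lemma cocktail_reach2 (u v : cocktail) : 1 < m -> reach 2 u v.
Proof.
move=> m1; have [uv|uv] := eqVneq u.1 v.1; last first.
  by apply: reach_leq (reach_adj (_ : adj u v)).
have [i iu] : exists i, i != u.1.
  apply/existsP; rewrite -negb_forall; apply/negP => /forallP h.
  have := max_card (pred1 u.1); have : #|'I_m| <= #|pred1 u.1|.
    by apply/subset_leq_card/subsetP => i _; exact: h.
  by rewrite card1 card_ord; lia.
have ui : @adj cocktail u (i, true) by rewrite /= /cocktail_adj /= eq_sym.
have iv : @adj cocktail (i, true) v by rewrite /= /cocktail_adj /= -uv.
exact: (adj_reach ui (reach_adj iv)).
Qed.

Lemma cocktail_far (u : cocktail) : exists v : cocktail, ~~ reach 1 u v.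
Proof.
exists (u.1, ~~ u.2); apply/negP => /reach1P[/(congr1 snd) /=|].
  by case: u.2.
by rewrite /= /cocktail_adj /= eqxx.
Qed.

Lemma cocktail_diam : 1 < m -> diam cocktail = 2%:N.
Proof.
move=> m1; apply: le_anti; apply/andP; split.
  by apply/diam_leP => u v; apply: cocktail_reach2.
apply: enat_leN (diam_enat _) _; apply/negP => /diam_leP h.
have [v] := cocktail_far (Ordinal m1, true).
by rewrite h.
Qed.

Lemma cocktail_radius : 1 < m -> radius cocktail = 2%:N.
Proof.
move=> m1; apply: le_anti; apply/andP; split.
  rewrite radius_le; apply/existsP; exists (Ordinal m1, true).
  by apply/forallP => v; apply: cocktail_reach2.
apply: enat_leN (radius_enat _) _.
rewrite radius_le; apply/negP => /existsP[u /forallP h].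
by have [v] := cocktail_far u; rewrite h.
Qed.

(* Each neighbor [a] of a central vertex misses some [y a] by more than [r]; a
   vertex of the cocktail party graph outside the parts of all [y a] is adjacent
   to all of them, so it is at distance at least [r] from every [a]. *)
Lemma card_inner_cocktail (H : sgraph) r (Z P : {set H}) (g : cocktail -> H) :
  ucg_of r Z P -> 1 < r -> {homo g : x y / adj x y} ->
  (forall v, v \in P <-> exists p, v = g p) -> m <= #|~: (Z :|: P)|.
Proof.
move=> U r1 hom gP; rewrite leqNgt; apply/negP => Im.
have [[c cZ] [_ /gP[p0 _]]] := (ucg_ne U, ucg_per_ne U).
have [y yP] : exists y : H -> cocktail, forall a,
    a \in ~: (Z :|: P) -> adj c a -> ~~ reach r a (g (y a)).
  apply: (fin_all_exists (P := fun a q =>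
    a \in ~: (Z :|: P) -> adj c a -> ~~ reach r a (g q))) => a.
  (* [p0] is a default value for the vertices that are not intermediate neighbors of [c]. *)
  have [[aI ca]|h] := pselect (a \in ~: (Z :|: P) /\ adj c a); last first.
    by exists p0 => aI ca; case: h.
  have [_ /gP[q ->] aq] := neighbor_far U r1 cZ ca (inner_notin_center aI).
  by exists q.
have [i iP] : exists i, i \notin [set (y a).1 | a in ~: (Z :|: P)].
  apply/existsP; rewrite -negb_forall; apply/negP => /forallP h.
  have : #|'I_m| <= #|[set (y a).1 | a in ~: (Z :|: P)]|.
    by apply/subset_leq_card/subsetP => j _; exact: h.
  rewrite card_ord leqNgt (leq_ltn_trans _ Im) //.
  exact: leq_imset_card.
have pP : g (i, true) \in P by apply/gP; eexists.
have [a [ca ap aI]] := first_step U r1 cZ pP.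
case/negP: (yP a aI ca); rewrite -(ltn_predK r1) -addn1.
apply: (reach_trans ap); apply/reach_adj/hom.
rewrite /= /cocktail_adj /=; apply: contra iP => /eqP ->.
exact: imset_f.
Qed.

End CocktailParty.

(** * Induced subgraphs as images of embeddings *)

Lemma giso_induced (H G : sgraph) (S : {set H}) (h : G -> H) :
  injective h -> {mono h : x y / adj x y} ->
  (forall v, v \in S <-> exists x, v = h x) -> giso (induced S) G.
Proof.
move=> h_inj h_mono hS.
have [f fP] : exists f : induced S -> G, forall x, val x = h (f x).
  apply: (fin_all_exists (P := fun (x : induced S) y => val x = h y)) => x.
  by apply/hS; apply: valP.
have hin x : h x \in S by apply/hS; exists x.
exists f; last by move=> x y; rewrite -h_mono -!fP.
exists (fun x => exist _ (h x) (hin x)) => x.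
  by apply: val_inj; rewrite /= fP.
by apply: h_inj; rewrite -fP.
Qed.

Lemma giso_embed (H G : sgraph) (S : {set H}) : giso (induced S) G ->
  exists g : G -> H, [/\ injective g, {mono g : x y / adj x y} &
    forall v, v \in S <-> exists x, v = g x].
Proof.
case=> f [f' fK f'K] f_mono; exists (fun x => val (f' x)); split.
- by move=> x y /val_inj /(can_inj f'K).
- by move=> x y; rewrite -[in RHS](f'K x) -[in RHS](f'K y) f_mono.
- move=> v; split=> [vS|[x ->]]; last exact: valP.
  by exists (f (exist _ v vS)); rewrite fK.
Qed.

(** * A uniform central graph with few intermediate vertices *)

Section Construction.
Variables (C P : sgraph) (k : nat) (S : pred P).

(* The intermediate vertices 0-1, 2-3 and 4-5 form three legs hanging from
   [C] by their even ends; 1 is joined to [S], 3 to its complement, and the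
   third leg (truncated when k < 6) is pendant. *)
Definition legs_adj : rel (C + P + 'I_k) := fun u v =>
  match u, v with
  | inl (inl c), inl (inl d) => adj c d
  | inl (inr p), inl (inr q) => adj p q
  | inr i, inr j => (i != j) && (i./2 == j./2)
  | inl (inl _), inr i | inr i, inl (inl _) => ~~ odd i
  | inl (inr p), inr i | inr i, inl (inr p) =>
    (i == 1 :> nat) && S p || (i == 3 :> nat) && ~~ S p
  | _, _ => false
  end.

Lemma legs_sym : symmetric legs_adj.
Proof.
move=> [[c|p]|i] [[d|q]|j] //=; try exact: adj_sym.
by rewrite eq_sym (eq_sym i./2).
Qed.

Lemma legs_irr : irreflexive legs_adj.
Proof. by move=> [[c|p]|i] /=; rewrite ?adj_irr // eqxx. Qed.

Definition legs : sgraph := SGraph legs_sym legs_irr.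

Definition inC (c : C) : legs := inl (inl c).
Definition inP (p : P) : legs := inl (inr p).
Definition inI (i : 'I_k) : legs := inr i.

Definition legsC : {set legs} := [set v | if v is inl (inl _) then true else false].
Definition legsP : {set legs} := [set v | if v is inl (inr _) then true else false].

Hypothesis k4 : 3 < k.
Hypothesis k6 : k <= 6.

Definition leg i (ik : i < k) : legs := inI (Ordinal ik).

Definition close (m n : nat) := (m <= n.+1) && (n <= m.+1).

(* Distances in [legs] are bounded below by 1-Lipschitz functions, constant
   on [C]. *)
Definition potential fc (s : seq nat) (fp : P -> nat) (v : legs) : nat :=
  match v with
  | inl (inl _) => fc
  | inl (inr p) => fp p
  | inr i => nth 0 s i
  end.

(** The Lipschitz condition edge by edge: from [C] to the tops, along the legs, inside [P], and from
    [P] to the feet 1 and 3. *)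
Definition potential_ok fc s fp :=
  [/\ [&& close fc (nth 0 s 0), close fc (nth 0 s 2) & close fc (nth 0 s 4)],
      [&& close (nth 0 s 0) (nth 0 s 1), close (nth 0 s 2) (nth 0 s 3)
        & close (nth 0 s 4) (nth 0 s 5)],
      forall p q : P, adj p q -> fp q <= (fp p).+1,
      forall p, S p -> close (fp p) (nth 0 s 1)
    & forall p, ~~ S p -> close (fp p) (nth 0 s 3)].

Lemma potential_far fc s fp n u v : potential_ok fc s fp ->
  potential fc s fp u + n < potential fc s fp v -> ~~ reach n u v.
Proof.
case=> /and3P[h0 h2 h4] /and3P[h01 h23 h45] hp hS hNS lt.
apply/negP => uv; move: lt; rewrite ltnNge (reach_lip _ uv) //.
have small (i : 'I_k) : i < 6 by apply: leq_trans k6.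
move=> {u v uv n} [[c|p]|i] [[d|q]|j] //=.
- have := small j; case: (nat_of_ord j) => [|[|[|[|[|[|?]]]]]] //= _ _.
  + by case/andP: h0.
  + by case/andP: h2.
  + by case/andP: h4.
- exact: hp.
- case/orP=> /andP[/eqP-> Sp]; first by case/andP: (hS _ Sp).
  by case/andP: (hNS _ Sp).
- have := small i; case: (nat_of_ord i) => [|[|[|[|[|[|?]]]]]] //= _ _.
  + by case/andP: h0.
  + by case/andP: h2.
  + by case/andP: h4.
- case/orP=> /andP[/eqP-> Sp]; first by case/andP: (hS _ Sp).
  by case/andP: (hNS _ Sp).
- rewrite -(inj_eq val_inj) /=; move: (small i) (small j).
  case: (nat_of_ord i) => [|[|[|[|[|[|?]]]]]] //;
  case: (nat_of_ord j) => [|[|[|[|[|[|?]]]]]] //= _ _ _.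
  + by case/andP: h01.
  + by case/andP: h01.
  + by case/andP: h23.
  + by case/andP: h23.
  + by case/andP: h45.
  + by case/andP: h45.
Qed.

Lemma legs_reach2 (c : C) (i : 'I_k) : reach 2 (inC c) (inI i).
Proof.
have [oi|ei] := boolP (odd i); last first.
  by apply: reach_leq (reach_adj (_ : adj (inC c) (inI i))).
have ik : i.-1 < k by apply: leq_ltn_trans (leq_pred _) (ltn_ord i).
have i0 : 0 < i by apply: odd_gt0.
have ci : adj (inC c) (leg ik) by rewrite /=; lia.
have ii : adj (leg ik) (inI i).
  by rewrite /= -(inj_eq val_inj) /=; apply/andP; split; [lia|apply/eqP; lia].
exact: adj_reach ci (reach_adj ii).
Qed.

Lemma legs_reach3 (c : C) (v : legs) : reach 3 (inC c) v.
Proof.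
case: v => [[d|p]|i]; last by apply: reach_leq (legs_reach2 c i).
  have k0 : 0 < k by apply: leq_trans k4.
  have ci : adj (inC c) (leg k0) by [].
  have id : adj (leg k0) (inC d) by [].
  exact: reach_leq (adj_reach ci (reach_adj id)).
have foot i (ik : i < k) : adj (leg ik) (inP p) -> reach 3 (inC c) (inP p).
  by move=> ip; apply: (reach_trans (legs_reach2 c (Ordinal ik))); apply: reach_adj.
have k1 : 1 < k by apply: leq_trans k4.
have [Sp|nSp] := boolP (S p); first by apply: (foot 1 k1); rewrite /= Sp.
by apply: (foot 3 k4); rewrite /= nSp.
Qed.

Definition near (T : pred P) n p := [exists q, T q && reach n p q].

Lemma near_adj (T : pred P) n p q : adj p q -> near T n p -> near T n.+1 q.
Proof.
move=> pq /existsP[t /andP[Tt pt]]; apply/existsP; exists t.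
by rewrite Tt (adjC_reach pq pt).
Qed.

Lemma near_self (T : pred P) n p : T p -> near T n p.
Proof. by move=> Tp; apply/existsP; exists p; rewrite Tp reachxx. Qed.

Lemma nearW (T : pred P) m n p : m <= n -> near T m p -> near T n p.
Proof.
move=> mn /existsP[t /andP[Tt pt]]; apply/existsP; exists t.
by rewrite Tt (reach_leq mn pt).
Qed.

(** The distance to [T] in [P], truncated at 3. *)
Definition level (T : pred P) p :=
  if T p then 0 else if near T 1 p then 1 else if near T 2 p then 2 else 3.

Lemma level_lip (T : pred P) p q : adj p q -> level T q <= (level T p).+1.
Proof.
move=> pq; rewrite /level.
have h0 : T p -> near T 1 q by move=> /(near_self 0) /(near_adj pq).
have h1 : near T 1 p -> near T 2 q by apply: near_adj.
case: (T p) (T q) h0 => [] [] // h0; first by rewrite h0.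
case: (near T 1 p) h1 => [h1|_]; first by rewrite h1 //; case: ifP.
by case: (near T 1 q); case: (near T 2 p); case: (near T 2 q).
Qed.

Lemma level_far (T : pred P) e p : 0 < e <= 2 -> ~~ near T e p ->
  e.+1 <= level T p.
Proof.
move=> e2 nT; rewrite /level ifN; last first.
  by apply: contra nT => Tp; apply: near_self.
rewrite ifN; last by apply: contra nT; apply: nearW; case/andP: e2.
case: ifP => // h2; last by case/andP: e2.
rewrite ltnS leqNgt; apply/negP => e1.
by case/negP: nT; apply: nearW h2.
Qed.

Variables (e : nat) (x y : P).
Hypothesis e12 : 0 < e <= 2.
Hypothesis k6_e2 : k = 6 \/ e = 2.
Hypothesis Sy : ~~ near S e y.
Hypothesis Sx : ~~ near (predC S) e x.
Hypothesis k5_closed : 4 < k \/ forall p q, adj p q -> S p = S q.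

(** With [T] the neighbors in [P] of the foot of the leg, the top is at distance 2 from [T], hence 4
    from [z]. The cap 4 accounts for the detour through [C] and another leg. *)
Lemma leg_top_far T (s : seq nat) i (ik : i < k) z : nth 0 s i = 0 ->
  potential_ok 1 s (fun p => minn 4 (2 + level T p)) ->
  ~~ near T e z -> ~~ reach 3 (leg ik) (inP z).
Proof.
move=> si ok /(level_far e12) h; apply: potential_far ok _.
by rewrite /= si; case/andP: e12; lia.
Qed.

(** The foot is at distance 1 from [T]. It misses the pendant end 5 if there is one; otherwise
    [e = 2] and [z] is at distance at least 3 from [T]. *)
Lemma leg_foot_far T (s : seq nat) i (ik : i < k) z :
  nth 0 s i = 0 -> nth 0 s 5 = 4 ->
  potential_ok 2 s (fun p => minn 4 (1 + level T p)) ->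
  ~~ near T e z -> exists u, ~~ reach 3 (leg ik) u.
Proof.
move=> si s5 ok /(level_far e12) h; case: k6_e2 => [kE|eE].
  have k5 : 5 < k by rewrite kE.
  by exists (leg k5); apply: potential_far ok _; rewrite /= si s5.
exists (inP z); apply: potential_far ok _.
by rewrite /= si; rewrite eE in h; lia.
Qed.

Lemma legs_far (v : legs) : v \notin legsC -> exists u, ~~ reach 3 v u.
Proof.
have k0 : 0 < k by apply: leq_trans k4.
have k2 : 2 < k by apply: leq_trans k4.
have lip b T p q : adj p q ->
    minn 4 (b + level T q) <= (minn 4 (b + level T p)).+1.
  by move=> /(level_lip T); lia.
have ge1 T p : ~~ T p -> 0 < level T p.
  by move=> nT; rewrite /level ifN //; do 2?case: ifP.
have le0 (T : pred P) p : T p -> level T p = 0 by rewrite /level => ->.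
have pend : potential_ok 1 [:: 2; 3; 2; 3; 0; 1] (fun _ => 4) by [].
case: v => [[c|p]|[i ik]]; first by rewrite inE.
(* The pendant leg is far from all of [P]; without it, [S] is closed under adjacency and [p] is far
   from the top of the other leg. *)
- move=> _; case: (ltnP 4 k) => [k5|kle].
    by exists (leg k5); rewrite reach_sym; apply: potential_far pend _.
  have cl p' q : adj p' q -> S p' = S q.
    by case: k5_closed => [k5|]; [rewrite ltnNge kle in k5|apply].
  have [Sp|nSp] := boolP (S p).
    exists (leg k2); apply: (potential_far (fc := 3) (s := [:: 2; 1; 4; 5; 4; 5])
      (fp := fun q => if S q then 0 else 6)); last by rewrite /= Sp.
    split=> //= [p' q /cl ->|q ->|q /negPf ->] //.
  exists (leg k0); apply: (potential_far (fc := 3) (s := [:: 4; 5; 2; 1; 4; 5])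
    (fp := fun q => if S q then 6 else 0)); last by rewrite /= (negPf nSp).
  split=> //= [p' q /cl ->|q ->|q /negPf ->] //.
move=> _; have := leq_trans ik k6.
case: i ik => [|[|[|[|[|[|//]]]]]] ik _.
- exists (inP y); apply: (leg_top_far (T := S) (s := [:: 0; 1; 2; 3; 2; 3])) => //.
  split=> //= [|p /le0->|p /ge1] //; first exact: lip.
  by rewrite /close; lia.
- apply: (leg_foot_far (T := S) (s := [:: 1; 0; 3; 3; 3; 4])) Sy => //.
  split=> //= [|p /le0->|p /ge1] //; first exact: lip.
  by rewrite /close; lia.
- exists (inP x); apply: (leg_top_far (T := predC S) (s := [:: 2; 3; 0; 1; 2; 3])) => //.
  split=> //= [|p Sp|p Sp]; first exact: lip.
    by have := @ge1 (predC S) p; rewrite /= Sp => /(_ isT); rewrite /close; lia.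
  by rewrite (le0 (predC S)).
- apply: (leg_foot_far (T := predC S) (s := [:: 3; 3; 1; 0; 3; 4])) Sx => //.
  split=> //= [|p Sp|p Sp]; first exact: lip.
    by have := @ge1 (predC S) p; rewrite /= Sp => /(_ isT); rewrite /close; lia.
  by rewrite (le0 (predC S)).
- by exists (inP x); apply: potential_far pend _.
- exists (inP x).
  by apply: (potential_far (fc := 2) (s := [:: 3; 4; 3; 4; 1; 0]) (fp := fun _ => 5)).
Qed.

Lemma legs_ucg_of : (exists c : C, true) -> ucg_of 3 legsC legsP.
Proof.
case=> c0 _; split.
- by exists (inC c0); rewrite inE.
- by exists (inP x); rewrite inE.
- by move=> [[c|p]|i] v; rewrite inE // => _; apply: legs_reach3.
- move=> [[c|p]|i] v; rewrite inE // => _ /=.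
  rewrite inE; case: v => [[d|p]|i].
  + have k0 : 0 < k by apply: leq_trans k4.
    have ci : adj (inC c) (leg k0) by [].
    have id : adj (leg k0) (inC d) by [].
    by rewrite (adj_reach ci (reach_adj id)).
  + apply/esym.
    by apply: (potential_far (fc := 0) (s := [:: 1; 2; 1; 2; 1; 2]) (fp := fun _ => 3)).
  + by rewrite legs_reach2.
- exact: legs_far.
Qed.

Lemma legs_A_ucg : (exists c : C, true) -> (A_ucg C P <= k%:N)%E.
Proof.
move=> c0; apply/nat_inf_leP; exists k => //.
have [uH ZE PE] := ucg_of_center (ltn0Sn 2) (legs_ucg_of c0).
exists legs; split=> //.
- rewrite ZE; apply: (giso_induced (h := inC)) => [c d [] //|//|v].
  rewrite inE; case: v => [[c|p]|i]; split=> //; try by case.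
  by exists c.
- rewrite PE; apply: (giso_induced (h := inP)) => [c d [] //|//|v].
  rewrite inE; case: v => [[c|p]|i]; split=> //; try by case.
  by exists p.
- rewrite /intermediate ZE PE.
  have -> : ~: (legsC :|: legsP) = inI @: setT.
    apply/setP => -[[c|p]|i]; rewrite !inE /=; apply/esym.
    + by apply/imsetP => -[].
    + by apply/imsetP => -[].
    + by apply/imsetP; exists i.
  by rewrite card_imset ?cardsT ?card_ord // => i j [].
Qed.

End Construction.

(** Take for [S] the ball of radius [e] around [u]: then [u] is far from its complement and [v] is
    far from [S]. *)
Lemma A_ucg_le_ball (C P : sgraph) k e (u v : P) : (exists c : C, true) ->
  3 < k <= 6 -> 0 < e <= 2 -> k = 6 \/ (k = 5 /\ e = 2) ->
  ~~ reach e.*2 u v -> (A_ucg C P <= k%:N)%E.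
Proof.
move=> c0 /andP[k4 k6] e12 ke uv.
apply: (@legs_A_ucg C P k (reach e u) k4 k6 e u v) => //.
- by case: ke => [|[_]]; [left|right].
- apply: contra uv => /existsP[s /andP[us vs]]; rewrite -addnn.
  by apply: (reach_trans us); rewrite reach_sym.
- by apply/existsP => -[s /andP[/negP us su]].
- by left; case: ke => [->|[->]].
Qed.

(** Here [S] is the connected component of [u], so no edge of [P] joins [S] to its complement and
    the two legs suffice. *)
Lemma A_ucg_le_disconnected (C P : sgraph) (u v : P) : (exists c : C, true) ->
  (forall n, ~~ reach n u v) -> (A_ucg C P <= 4%:N)%E.
Proof.
move=> c0 uv; pose S p := `[< exists n, reach n u p >].
have SS p q : adj p q -> S p -> S q.
  move=> pq /asboolP[n un]; apply/asboolP; exists (n + 1).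
  exact: reach_trans un (reach_adj pq).
apply: (@legs_A_ucg C P 4 S isT isT 2 u v) => //.
- by right.
- apply/existsP => -[s /andP[/asboolP[n us] vs]]; case/negP: (uv (n + 2)).
  by apply: (reach_trans us); rewrite reach_sym.
- apply/existsP => -[s /andP[/negP us su]]; apply: us.
  by apply/asboolP; exists 2.
- right=> p q pq; apply/idP/idP; apply: SS => //.
  by rewrite adj_sym.
Qed.

(** * Lower bounds for [A_ucg] *)

Section Bounds.
Variables (C P : sgraph).
Hypothesis hC : (1%:N < diam C)%E.

Let C_far : exists u v : C, ~~ reach 1 u v.
Proof.
apply: diam_far; apply: enat_leN (diam_enat C) _.
by rewrite -ltNge.
Qed.

Lemma C_inhab : exists c : C, true.
Proof. by have [u _] := C_far; exists u. Qed.

Lemma A_ucg_geP n :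
  (forall (H : sgraph) r (Z PP : {set H}) (g : P -> H),
     ucg_of r Z PP -> 2 < r -> {homo g : x y / adj x y} ->
     (forall v, v \in PP <-> exists p, v = g p) -> n <= #|~: (Z :|: PP)|) ->
  (n%:N <= A_ucg C P)%E.
Proof.
move=> h; apply/nat_inf_geP => k [H [uH isoC isoP <-]].
have [gC [gC_inj gC_mono gCP]] := giso_embed isoC.
have [g [_ g_mono gP]] := giso_embed isoP.
have [r r2 U] : exists2 r, 2 < r & ucg_of r (center H) (CP H).
  apply: ucg_of_ucg => //; have [u [v uv]] := C_far.
  exists (gC u), (gC v); split; try by apply/gCP; eexists.
    by apply: contra uv => /eqP /gC_inj ->; apply: reachxx.
  by rewrite gC_mono; apply: contra uv; apply: reach_adj.
by apply: h U r2 _ gP => p q; rewrite g_mono.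
Qed.

Lemma A_ucg_ge4 : (4%:N <= A_ucg C P)%E.
Proof.
apply: A_ucg_geP => H r Z PP g U r2 _ _.
by apply: leq_trans (card_inner U (ltnW r2)); lia.
Qed.

Hypothesis conn : forall p q : P, exists n, reach n p q.

(** At most 5 intermediate vertices force [r = 3] by [card_inner]. For [n = 6], the assumption on
    [P] contradicts both alternatives of [card_inner_conn]. *)
Lemma A_ucg_ge_conn n : 4 < n <= 6 ->
  (n = 6 -> (forall p q : P, reach 4 p q) /\
    ((forall p q : P, reach 3 p q) \/ exists o : P, forall p, reach 2 o p)) ->
  (n%:N <= A_ucg C P)%E.
Proof.
move=> n56 hn; apply: A_ucg_geP => H r Z PP g U r2 hom gP.
have [I5|I6] := leqP #|~: (Z :|: PP)| 5; last by case/andP: n56; lia.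
have r3 : r = 3.
  by have := leq_trans (card_inner U (ltnW r2)) I5; move: r2; clear; lia.
rewrite r3 in U; have [IE far] := card_inner_conn U hom gP conn I5.
rewrite IE leqNgt; apply/negP => n5.
have [|h4 h23] := hn; first by case/andP: n56; lia.
case: far => [[p [q]]|[[p [q pq]] no]]; first by rewrite h4.
by case: h23 => // h3; rewrite h3 in pq.
Qed.

End Bounds.

Lemma diam_fin_conn (P : sgraph) : (diam P < +oo)%E ->
  forall p q : P, exists n, reach n p q.
Proof.
case: (diam_enat P) => [->|[n dn _] p q]; first by rewrite ltxx.
by exists n; move: p q; apply/diam_leP; rewrite dn.
Qed.

Local Open Scope ring_scope.
Local Open Scope ereal_scope.

Theorem theorem6p4 (C : sgraph) (hC : 1%:Z%:E < diam C) :
  (forall P : sgraph,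
     [/\ diam P = +oo -> A_ucg C P = 4%:Z%:E,
         5%:Z%:E <= diam P < +oo -> A_ucg C P = 5%:Z%:E,
         diam P = 4%:Z%:E -> radius P = 4%:Z%:E ->
           A_ucg C P = 5%:Z%:E \/ A_ucg C P = 6%:Z%:E,
         diam P = 4%:Z%:E -> radius P = 2%:Z%:E -> A_ucg C P = 6%:Z%:E
       & diam P = 3%:Z%:E -> A_ucg C P = 6%:Z%:E]) /\
  (forall t : int, exists P : sgraph,
     [/\ diam P = 2%:Z%:E, radius P = 2%:Z%:E & t%:E <= A_ucg C P]).
Proof.
have c0 := C_inhab hC.
split=> [P|t].
  have le6 : 3%:Z%:E <= diam P -> A_ucg C P <= 6%:Z%:E.
    case/(@diam_far P 2) => u [v uv].
    by apply: (@A_ucg_le_ball C P 6 1 u v) => //; left.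
  have conn n : diam P = n%:Z%:E -> forall p q : P, exists k, reach k p q.
    by move=> dn; apply: diam_fin_conn; rewrite dn ltry.
  split=> [dy|/andP[d5 dfin]|d4 _|d4 r2|d3].
  - apply: le_anti; rewrite (A_ucg_ge4 P hC) andbT.
    by have [u [v uv]] := diamy dy; apply: A_ucg_le_disconnected uv.
  - apply: le_anti; apply/andP; split.
      case/(@diam_far P 4): d5 => u [v uv].
      by apply: (@A_ucg_le_ball C P 5 2 u v) => //; right.
    exact: (A_ucg_ge_conn hC (diam_fin_conn dfin)).
  - have : 5%:Z%:E <= A_ucg C P by exact: (A_ucg_ge_conn hC (conn _ d4)).
    have := le6; rewrite d4 lee_enat => /(_ isT).
    case: (nat_inf_enat _ : is_enat (A_ucg C P)) => [->|[n ->]].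
      by rewrite leye_eq.
    rewrite !lee_enat => n6 n5; have [->|->] : n = 5%N \/ n = 6%N by lia.
      by left.
    by right.
  - apply: le_anti; rewrite le6 ?d4 ?lee_enat //=.
    apply: (A_ucg_ge_conn hC (conn _ d4)) => // _; split.
      by apply/diam_leP; rewrite d4.
    right; have : radius P <= 2%:Z%:E by rewrite r2.
    by rewrite radius_le => /existsP[o /forallP ho]; exists o.
  - apply: le_anti; rewrite le6 ?d3 //=.
    apply: (A_ucg_ge_conn hC (conn _ d3)) => // _; split.
      by apply/diam_leP; rewrite d3 lee_enat.
    by left; apply/diam_leP; rewrite d3.
(* The summand 2 provides the two parts needed for diameter 2. *)
exists (cocktail `|t|.+2); split.
- exact: cocktail_diam.
- exact: cocktail_radius.
apply: (@le_trans _ _ (`|t|.+2)%:Z%:E); first by rewrite lee_fin; lia.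
apply: (A_ucg_geP hC) => H r Z PP g U r2 hom gP.
exact: card_inner_cocktail U (ltnW r2) hom gP.
Qed.
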